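(* Let $p\in\mathbb{C}[z]$ be a complex polynomial of degree $n\ge 2$ with roots $\{\lambda_j\}_{j=1}^n$, and let $\{\mu_j\}_{j=1}^{n-1}$ be the roots of its derivative $p'$ (roots listed with multiplicity). Then $$C_k(\{\mu_j-\alpha\}_{j=1}^{n-1})\prec_{uds} C_k(\{\lambda_j-\alpha\}_{j=1}^{n})$$ for every $\alpha\in\mathbb{C}$ and every $k\in\{1,\ldots,n-1\}$. In particular, setting $\mu_n:=\frac1n\sum_{j=1}^n\lambda_j$, $\mu:=(\mu_1,\ldots,\mu_n)^T$ and $\lambda:=(\lambda_1,\ldots,\lambda_n)^T$, there exists a bistochastic matrix $S\in M_n(\mathbb{R})$ such that $\mu=S\lambda$.
   Context: A matrix in $M_N(\mathbb{R})$ is bistochastic (doubly stochastic) if all its entries are nonnegative and each row and each column sums to $1$. It is unitary-stochastic if its entries are $|u_{ij}|^2$ for some unitary $U=(u_{ij})\in M_N(\mathbb{C})$. For a vector $\{z_j\}_{j=1}^N\in\mathbb{C}^N$ and $1\le k\le N$, $C_k(\{z_j\}_{1}^N):=\{z_{i_1}\cdots z_{i_k}\}_{1\le i_1<\ldots<i_k\le N}\in\mathbb{C}^{\binom{N}{k}}$. For finite sequences of complex numbers $x=\{x_j\}_{j=1}^l$ and $y=\{y_j\}_{j=1}^N$ with $l\le N$, $x\prec_{uds}y$ means: there exist complex numbers $x_{l+1},\ldots,x_N$ and a unitary-stochastic matrix $S\in M_N(\mathbb{R})$ such that $(x_1,\ldots,x_N)^T=S(y_1,\ldots,y_N)^T$.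 *)

(* Defs.v *)
From mathcomp Require Import all_boot all_order all_algebra.
From mathcomp Require Import reals complex.
Set Implicit Arguments.
Unset Strict Implicit.
Unset Printing Implicit Defensive.
Import Order.TTheory GRing.Theory Num.Theory.

Local Open Scope ring_scope.
Local Open Scope complex_scope.

Definition bistochastic (R : realType) (N : nat) (S : 'M[R]_N) : Prop :=
  [/\ forall i j, 0 <= S i j,
      forall i, \sum_j S i j = 1
    & forall j, \sum_i S i j = 1].

Definition unitary_stochastic (R : realType) (N : nat) (S : 'M[R]_N) : Prop :=
  exists2 U : 'M[R[i]]_N,
    U \is unitarymx & forall i j, (S i j)%:C = `|U i j| ^+ 2.

(* The vector (x_1, ..., x_N)^T, meant for sequences of length N. *)
Definition colvec (R : realType) (N : nat) (x : seq R[i]) : 'cV[R[i]]_N :=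
  \col_(j < N) x`_j.

(* Strictly increasing k-tuples of indices give the terms i_1 < ... < i_k
   once each. The order in which they are enumerated is immaterial: the
   relation uds below is invariant under permutations of either sequence. *)
Definition Cseq (R : realType) (k : nat) (z : seq R[i]) : seq R[i] :=
  [seq \prod_(j < k) z`_(tnth t j)
  | t : k.-tuple 'I_(size z) in
      [set t : k.-tuple 'I_(size z) | sorted ltn (map val t)]].

(* The size condition says that x' supplies x_{l+1}, ..., x_N; in particular
   it forces size x <= size y. *)
Definition uds (R : realType) (x y : seq R[i]) : Prop :=
  exists (x' : seq R[i]) (S : 'M[R]_(size y)),
    [/\ size (x ++ x') = size y,
        unitary_stochastic S
      & colvec (size y) (x ++ x')
        = map_mx (real_complex R) S *m colvec (size y) y].

(* s lists the roots of p with multiplicity (meaningful for p != 0). *)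
Definition roots_of (R : realType) (p : {poly R[i]}) (s : seq R[i]) : Prop :=
  p = lead_coef p *: \prod_(z <- s) ('X - z%:P).

(* Main.v *)
(* Let U be a unitary matrix with one row of constant modulus 1/sqrt(n), and
   put A = U diag(lambda) U*.  Deleting that row and the matching column leaves
   a matrix whose characteristic polynomial is a diagonal entry of
   adj(X - A), i.e. the normalized p'.  By Schur triangularization the other
   rows of U can be chosen so that this compression is triangular with diagonal
   mu, up to a simultaneous permutation of rows and columns.  Reading off the
   diagonal of A gives mu = S lambda with S = (|u_ij|^2).  For general k, the
   Cauchy-Binet formula applied to A - alpha = U diag(lambda - alpha) U* does
   the same for principal k x k minors: the matrix of k x k minors of U is again
   unitary, and principal minors of a triangular matrix are products of its
   diagonal entries. *)
Require Import Defs.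
From mathcomp Require Import all_boot all_order all_algebra fingroup perm.
From mathcomp Require Import reals complex.
Import Order.TTheory GRing.Theory Num.Theory.
Local Open Scope ring_scope.
Local Open Scope complex_scope.
Local Open Scope sesquilinear_scope.

Set Implicit Arguments.
Unset Strict Implicit.
Unset Printing Implicit Defensive.

(** * Increasing index tuples, the Cauchy-Binet formula and determinants *)

Definition incr n k (t : k.-tuple 'I_n) := sorted ltn (map val t).

Lemma incr_uniq n k (t : k.-tuple 'I_n) : incr t -> uniq t.
Proof.
move=> /(sorted_uniq ltn_trans ltnn).
by rewrite map_inj_uniq //; exact: val_inj.
Qed.

Lemma incr_eq n k (s t : k.-tuple 'I_n) :
  incr s -> incr t -> s =i t -> s = t.
Proof.
move=> ss st e; apply: val_inj; apply: (inj_map val_inj).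
apply: (irr_sorted_eq ltn_trans ltnn) => // x.
by apply/mapP/mapP => -[y yi ->]; exists y; rewrite // ?e // -e.
Qed.

(* Non-injective row selections contribute zero; an injective one is uniquely
   an increasing selection followed by a permutation. *)
Lemma Cauchy_Binet (R : comNzRingType) n k (P : 'M[R]_(k, n)) (Q : 'M[R]_(n, k)) :
  \det (P *m Q) = \sum_(t : k.-tuple 'I_n | incr t)
     \det (colsub (tnth t) P) * \det (rowsub (tnth t) Q).
Proof.
pose F (t : k.-tuple 'I_n) :=
  \prod_i P i (tnth t i) * \det (rowsub (tnth t) Q).
(* Multilinearity in the rows: each row of [P *m Q] is a combination of the rows of [Q], and [t]
   records which row of [Q] is picked for each [i]. *)
have -> : \det (P *m Q) = \sum_t F t.
  have -> : \det (P *m Q) =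
      \sum_(s : 'S_k) \sum_(f : {ffun 'I_k -> 'I_n})
        (-1) ^+ s * \prod_i (P i (f i) * Q (f i) (s i)).
    apply: eq_bigr => s _; rewrite -big_distrr /=; congr (_ * _).
    rewrite -(bigA_distr_bigA (fun i j => P i j * Q j (s i))) /=.
    by apply: eq_bigr => i _; rewrite mxE.
  rewrite exchange_big /=.
  rewrite (reindex (fun t : k.-tuple 'I_n => [ffun i => tnth t i])) /=; last first.
    exists (fun f : {ffun 'I_k -> 'I_n} => [tuple f i | i < k]) => [t|f] _.
      by apply: eq_from_tnth => i; rewrite tnth_mktuple ffunE.
    by apply/ffunP => i; rewrite ffunE tnth_mktuple.
  apply: eq_bigr => t _; rewrite /F big_distrr /=; apply: eq_bigr => s _.
  rewrite big_split /= mulrCA; congr (_ * (_ * _)); apply: eq_bigr => i _.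
    by rewrite ffunE.
  by rewrite ffunE mxE.
rewrite (bigID (fun t : k.-tuple 'I_n => uniq t)) /= [X in _ + X]big1 ?addr0; last first.
  move=> t /tuple_uniqP ninj; rewrite /F.
  have /injectivePn[i [j ij tij]] : ~~ injectiveb (tnth t) by apply/injectiveP.
  by rewrite (determinant_alternate ij) ?mulr0 // => l; rewrite !mxE tij.
pose h (x : k.-tuple 'I_n * 'S_k) := [tuple tnth x.1 (x.2 i) | i < k].
pose A := [set x : k.-tuple 'I_n * 'S_k | incr x.1].
have permh x : perm_eq (h x) x.1 by apply/tuple_permP; exists x.2.
have hinj : {in A &, injective h}.
  move=> [t s] [t' s']; rewrite !inE /= => it it' e.
  have tt' : t = t'.
    apply: incr_eq => // z.
    by rewrite -(perm_mem (permh (t, s))) e (perm_mem (permh (t', s'))).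
  subst t'; congr pair; apply/permP => i.
  have tinj : injective (tnth t) by exact/tuple_uniqP/incr_uniq.
  apply: tinj.
  by have := congr1 (fun z => tnth z i) e; rewrite !tnth_mktuple.
have imh : h @: A =i [pred t : k.-tuple 'I_n | uniq t].
  move=> t; rewrite !inE; apply/imsetP/idP => [[x]|ut].
    by rewrite inE => ix ->; rewrite (perm_uniq (permh x)) incr_uniq.
  pose leo := [rel i j : 'I_n | (i <= j)%N].
  have /tuple_permP[s es] : perm_eq t [tuple of sort leo t].
    by rewrite perm_sym perm_sort.
  exists ([tuple of sort leo t], s); last exact: val_inj.
  rewrite inE /incr /= ltn_sorted_uniq_leq map_inj_uniq ?sort_uniq ?ut /=; last first.
    exact: val_inj.
  by rewrite sorted_map; apply: sort_sorted => i j; exact: leq_total.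
rewrite -(eq_bigl _ _ imh) (big_imset _ hinj) /=.
rewrite (eq_bigl (fun x => incr x.1 && true)) /=; last by move=> x; rewrite inE andbT.
rewrite -(pair_big (@incr n k) xpredT (fun t s => F (h (t, s)))) /=.
(* For fixed [t], the sum over [s] is the Leibniz formula for the minor of [P]; its signs come from
   permuting the rows of the minor of [Q]. *)
apply: eq_bigr => t _; rewrite /F /h /= [\det (colsub _ P)]/determinant big_distrl /=.
apply: eq_bigr => s _.
have -> : rowsub (tnth [tuple tnth t (s i)  | i < k]) Q =
          row_perm s (rowsub (tnth t) Q).
  by apply/matrixP => i j; rewrite !mxE tnth_mktuple.
rewrite row_permE det_mulmx det_perm mulrCA mulrA; congr (_ * _ * _).
by apply: eq_bigr => i _; rewrite mxE tnth_mktuple.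
Qed.

(* A matrix that becomes triangular after sorting rows and columns by [rk]. *)
Lemma det_ranked (R : comNzRingType) k (M : 'M[R]_k) (rk : 'I_k -> nat) :
  injective rk -> (forall i j, (rk i < rk j)%N -> M i j = 0) ->
  \det M = \prod_i M i i.
Proof.
move=> rki M0; rewrite /determinant (bigD1 (1 : {perm _})%g) //= odd_perm1 expr0 mul1r.
rewrite [X in _ + X]big1 ?addr0; first by apply: eq_bigr => i _; rewrite perm1.
move=> s s1; case: (boolP [exists i, (rk i < rk (s i))%N]) => [/existsP[i ri]|].
  by rewrite (bigD1 i) //= M0 // mul0r mulr0.
rewrite negb_exists => /forallP le; case/negP: s1; apply/eqP/permP => i.
rewrite perm1; apply: rki; apply/eqP; move: i isT.
(* No rank goes up under [s], while both rank sums agree by reindexing; hence every rank is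
   preserved and [s] is the identity. *)
have := @leqif_sum _ xpredT (fun i => rk (s i) == rk i) (fun i => rk (s i)) rk.
case=> [i _|_]; first by split; rewrite // leqNgt le.
rewrite [X in _ == X](reindex_inj (@perm_inj _ s)) eqxx => /esym/forallP ee i _.
by have := ee i.
Qed.
(** The adjugate turns [N] into the scalar [\det N], which cancels in a domain. This serves
    polynomial matrices, where [N] need not be invertible. *)
Lemma mulmx_det_inj (R : idomainType) n (X Y N : 'M[R]_n) :
  \det N != 0 -> X *m N = Y *m N -> X = Y.
Proof.
move=> N0 /(congr1 (mulmx^~ (\adj N))).
rewrite -!mulmxA mul_mx_adj !mul_mx_scalar => /matrixP e.
by apply/matrixP => i j; have := e i j; rewrite !mxE; apply: mulfI.
Qed.

Lemma deriv_prod_XsubC (R : comNzRingType) n (lam : 'I_n -> R) :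
  (\prod_i ('X - (lam i)%:P))^`() =
  \sum_i \prod_(j < n | j != i) ('X - (lam j)%:P).
Proof.
elim: n lam => [|n IH] lam; first by rewrite !big_ord0 derivC.
rewrite big_ord_recl derivM IH derivXsubC mul1r big_ord_recl; congr (_ + _).
  by rewrite [RHS]big_mkcond big_ord_recl eqxx /= mul1r; apply: eq_bigr.
rewrite big_distrr /=; apply: eq_bigr => i _.
by rewrite big_mkcond [RHS]big_mkcond big_ord_recl.
Qed.

(** * Unitary matrices, compressions and triangularization *)

Section Unitary.
Variable C : numClosedFieldType.

Lemma unitarymx_rowE m n (U : 'M[C]_(m, n)) : U \is unitarymx ->
  forall i l, \sum_j U i j * (U l j)^* = (i == l)%:R.
Proof.
move=> /unitarymxP/matrixP U1 i l; have := U1 i l; rewrite !mxE => <-.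
by apply: eq_bigr => j _; rewrite !mxE.
Qed.

Lemma conj_diagE n (U : 'M[C]_n) (d : 'I_n -> C) i l :
  (U *m diag_mx (\row_j d j) *m U^t* ) i l = \sum_j U i j * (U l j)^* * d j.
Proof.
by rewrite mxE; apply: eq_bigr => j _; rewrite mul_mx_diag !mxE mulrAC.
Qed.

(** Gram-Schmidt on the all-ones matrix: the first row of the result spans the all-ones vector, so
    it is constant, and its unit norm fixes the modulus. *)
Lemma unitarymx_flat_row m : exists2 V : 'M[C]_m.+1,
  V \is unitarymx & forall j, `|V ord0 j| ^+ 2 = m.+1%:R^-1.
Proof.
pose A : 'M[C]_m.+1 := const_mx 1; pose V := schmidt A.
have Vu : V \is unitarymx by exact: schmidt_unitarymx.
exists V => //.
have := row_schmidt_sub A ord0.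
rewrite (big_pred1 ord0) => [|k /=]; last by rewrite leqn0.
rewrite genmxE => /sub_rVP[a /rowP ea].
have aV j : a * V ord0 j = 1 by have := ea j; rewrite !mxE => <-.
have a0 : a != 0.
  by apply/eqP => a0; have /eqP := aV ord0; rewrite a0 mul0r eq_sym oner_eq0.
have VE j : V ord0 j = a^-1 by apply: (mulfI a0); rewrite aV mulfV.
have := unitarymx_rowE Vu ord0 ord0; rewrite eqxx.
under eq_bigr do rewrite VE -normCK.
rewrite sumr_const card_ord -[_ *+ _]mulr_natl => e j; rewrite VE.
by apply: (@mulfI _ m.+1%:R); rewrite ?pnatr_eq0 // e mulfV ?pnatr_eq0.
Qed.

(* [char_poly] of the compression is a diagonal entry of the adjugate of
   [X - A], and the adjugate of [X - diag lam] is explicit. *)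
Lemma char_poly_compression m (W : 'M[C]_m.+1) (lam : 'I_m.+1 -> C) :
  W \is unitarymx ->
  char_poly (row' ord0 (col' ord0 (W *m diag_mx (\row_i lam i) *m W^t* ))) =
  \sum_i (`|W ord0 i| ^+ 2) *: \prod_(j < m.+1 | j != i) ('X - (lam j)%:P).
Proof.
move=> Wu; set A := _ *m _ *m _.
pose Wp := map_mx polyC W; pose Vp := map_mx polyC (W^t* ).
pose D := diag_mx (\row_i ('X - (lam i)%:P)) : 'M[{poly C}]_m.+1.
pose X := diag_mx (\row_i \prod_(j < m.+1 | j != i) ('X - (lam j)%:P)) : 'M[{poly C}]_m.+1.
have WV : Wp *m Vp = 1%:M by rewrite -map_mxM (unitarymxP Wu) map_mx1.
have VW : Vp *m Wp = 1%:M by exact: mulmx1C.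
have eA : char_poly_mx A = Wp *m D *m Vp.
  have -> : D = 'X%:M - map_mx polyC (diag_mx (\row_i lam i)).
    apply/matrixP => i j; rewrite !mxE; case: eqP => _ //.
    by rewrite !mulr0n polyC0 subr0.
  rewrite mulmxBr mulmxBl mul_mx_scalar -scalemxAl WV scalemx1.
  by rewrite -!map_mxM.
have dA : \det (char_poly_mx A) = \prod_i ('X - (lam i)%:P).
  rewrite eA !det_mulmx mulrC mulrA -det_mulmx VW det1 mul1r det_diag.
  by apply: eq_bigr => i _; rewrite mxE.
have XD : X *m D = (\prod_i ('X - (lam i)%:P))%:M.
  rewrite mulmx_diag; apply/matrixP => i j; rewrite !mxE.
  by case: eqP => // ->; rewrite [in RHS](bigD1 j) //= mulrC.
(* Both sides agree after multiplication by [char_poly_mx A], whose determinant is monic, hence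
   nonzero. *)
have adjA : \adj (char_poly_mx A) = Wp *m X *m Vp.
  apply: (@mulmx_det_inj _ _ _ _ (char_poly_mx A)).
    by rewrite dA monic_neq0 // monic_prod_XsubC.
  rewrite mul_adj_mx dA eA !mulmxA -(mulmxA (Wp *m X) Vp) VW mulmx1.
  by rewrite -(mulmxA Wp) XD mul_mx_scalar -scalemxAl WV scalemx1.
have <- : \adj (char_poly_mx A) ord0 ord0 = char_poly (row' ord0 (col' ord0 A)).
  rewrite mxE /cofactor addn0 expr0 mul1r /char_poly -row'_col'_char_poly_mx.
  by [].
rewrite adjA mxE; apply: eq_bigr => i _; rewrite mul_mx_diag !mxE mulrAC.
by rewrite -polyCM -normCK mul_polyC.
Qed.

Lemma unitarymx_rowsub n (f : 'I_n -> 'I_n) (U : 'M[C]_n) : injective f ->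
  U \is unitarymx -> rowsub f U \is unitarymx.
Proof.
move=> fi Uu; apply/unitarymxP/matrixP => i j; rewrite !mxE.
under eq_bigr do rewrite !mxE.
by rewrite unitarymx_rowE // (inj_eq fi).
Qed.

(** A flat row makes [mu] the spectrum of the compression. Schur triangularization lists these roots
    in an uncontrolled order, which [s] matches with [mu]. The flat row ends up last, where the mean
    of the roots is wanted. *)
Lemma unitary_triangularization m (lam : 'I_m.+2 -> C) (mu : m.+1.-tuple C) :
  (\prod_i ('X - (lam i)%:P))^`() = m.+2%:R *: \prod_(z <- mu) ('X - z%:P) ->
  exists (U : 'M[C]_m.+2) (s : {perm 'I_m.+1}),
    let A := U *m diag_mx (\row_i lam i) *m U^t* in
    [/\ U \is unitarymx,
        forall i, A (lift ord_max i) (lift ord_max i) = tnth mu i,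
        forall i j, (s i < s j)%N -> A (lift ord_max i) (lift ord_max j) = 0
      & forall j, `|U ord_max j| ^+ 2 = m.+2%:R^-1].
Proof.
move=> dlam; have [W Wu W0] := unitarymx_flat_row m.+1.
set L := diag_mx (\row_i lam i).
pose A0 : 'M[C]_(1 + m.+1) := W *m L *m W^t*.
pose B := drsubmx A0.
have cB : char_poly B = \prod_(z <- mu) ('X - z%:P).
  have -> : B = row' ord0 (col' ord0 A0).
    by apply/matrixP => i j; rewrite !mxE !rshift1.
  rewrite (char_poly_compression lam Wu).
  transitivity (\sum_i m.+2%:R^-1 *: \prod_(j < m.+2 | j != i) ('X - (lam j)%:P)).
    by apply: eq_bigr => i _; congr (_ *: _); exact: W0.
  rewrite -scaler_sumr -deriv_prod_XsubC dlam scalerA mulVf ?scale1r //.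
  by rewrite pnatr_eq0.
have [P Pu Ptrig] := Schur B (ltn0Sn m).
pose T := P *m B *m P^t*.
have Tt : is_trig_mx T by rewrite /T -conjymx.
have cT : char_poly T = char_poly B.
  have PV : map_mx polyC P *m map_mx polyC (P^t* ) = 1%:M.
    by rewrite -map_mxM (unitarymxP Pu) map_mx1.
  have eT : char_poly_mx T = map_mx polyC P *m char_poly_mx B *m map_mx polyC (P^t* ).
    rewrite /char_poly_mx mulmxBr mulmxBl mul_mx_scalar -scalemxAl PV scalemx1.
    by rewrite -!map_mxM.
  rewrite /char_poly eT !det_mulmx mulrC mulrA -det_mulmx.
  by rewrite (mulmx1C PV) det1 mul1r.
have /tuple_permP[s es] : perm_eq mu [tuple T i i | i < m.+1].
  apply: prod_XsubC_eq; rewrite -cB -cT char_poly_trig //.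
  by rewrite [RHS]big_map big_enum.
have {}es i : tnth mu i = T (s i) (s i).
  by rewrite (_ : mu = [tuple tnth [tuple T i i | i < m.+1] (s i) | i < m.+1])
       ?tnth_mktuple //; apply: val_inj.
(* The identity block keeps the flat row, while [P] triangularizes [B]. *)
pose Q : 'M[C]_(1 + m.+1) := block_mx 1%:M 0 0 P.
have Qu : Q \is unitarymx.
  apply/unitarymxP; rewrite tr_block_mx map_block_mx mulmx_block.
  rewrite !trmx0 !map_mx0 !mulmx0 !mul0mx trmx1 map_mx1 mulmx1 !addr0 !add0r.
  by rewrite (unitarymxP Pu) -scalar_mx_block.
(* The last index receives row 0, the flat one; the index of each root in [mu] receives the row
   where that root sits on the diagonal. *)
pose f (i : 'I_m.+2) := if unlift ord_max i is Some j then lift ord0 (s j) else ord0.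
have fi : injective f.
  move=> i j; rewrite /f; case: unliftP => [i'|] ->; case: unliftP => [j'|] -> //.
  by move=> /lift_inj/perm_inj ->.
pose U0 : 'M[C]_(1 + m.+1) := Q *m W.
pose U : 'M[C]_m.+2 := rowsub f U0.
have U0u : U0 \is unitarymx by rewrite mul_unitarymx.
have A1 : U0 *m L *m U0^t* = Q *m A0 *m Q^t*.
  by rewrite /U0 /A0 trmx_mul map_mxM !mulmxA.
have AE i j : (U *m L *m U^t* ) i j = (U0 *m L *m U0^t* ) (f i) (f j).
  by rewrite !conj_diagE; apply: eq_bigr => l _; rewrite !mxE.
have dr : drsubmx (U0 *m L *m U0^t* ) = T.
  rewrite A1 -[A0]submxK tr_block_mx map_block_mx !mulmx_block block_mxKdr.
  by rewrite !mul0mx trmx0 map_mx0 !mulmx0 !add0r.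
have AT i j : (U *m L *m U^t* ) (lift ord_max i) (lift ord_max j) = T (s i) (s j).
  by rewrite AE /f !liftK -dr !mxE !rshift1.
exists U, s; split=> [|i|i j sij|j].
- exact: unitarymx_rowsub.
- by rewrite AT es.
- by rewrite AT; move/is_trig_mxP: Tt => ->.
suff -> : U ord_max j = W ord0 j by exact: W0.
have e0 : ord0 = lshift m.+1 (ord0 : 'I_1) by apply: val_inj.
rewrite !mxE /f unlift_none big_ord_recl big1 => [|i _].
  by rewrite addr0 e0 block_mxEul mxE eqxx mul1r.
have -> : lift ord0 i = rshift 1 i by apply: val_inj.
by rewrite e0 block_mxEur mxE mul0r.
Qed.

End Unitary.

(** * Compound matrices, that is, matrices of minors *)

Lemma minor_conj_diag (C : numClosedFieldType) n k (U : 'M[C]_n)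
    (d : 'I_n -> C) (a b : k.-tuple 'I_n) :
  \det (mxsub (tnth a) (tnth b) (U *m diag_mx (\row_j d j) *m U^t* )) =
  \sum_(t : k.-tuple 'I_n | incr t)
    \det (mxsub (tnth a) (tnth t) U) * (\det (mxsub (tnth b) (tnth t) U))^* *
    \prod_(j < k) d (tnth t j).
Proof.
(* The first factor is [U] with columns scaled by [d], so the product of the selected [d] comes out
   of each of its minors. *)
rewrite mxsub_mul Cauchy_Binet; apply: eq_bigr => t _; rewrite mulrAC.
congr (_ * _); last first.
  by rewrite -det_map_mx -det_tr; congr (\det _); apply/matrixP => i j; rewrite !mxE.
transitivity (\det (mxsub (tnth a) (tnth t) U *m diag_mx (\row_j d (tnth t j)))).
  by congr (\det _); apply/matrixP => i j; rewrite !mul_mx_diag !mxE.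
by rewrite det_mulmx det_diag; congr (_ * _); apply: eq_bigr => i _; rewrite mxE.
Qed.

Lemma det_mxsub1 (R : comNzRingType) n k (a b : k.-tuple 'I_n) :
  incr a -> incr b -> \det (mxsub (tnth a) (tnth b) (1%:M : 'M[R]_n)) = (a == b)%:R.
Proof.
move=> ia ib; case: eqP => [<-|ab].
  have inja : injective (tnth a) by exact/tuple_uniqP/incr_uniq.
  rewrite (_ : mxsub _ _ _ = 1%:M) ?det1 //.
  by apply/matrixP => i j; rewrite !mxE (inj_eq inja).
(* Equal lengths: inclusion of entries would force [a = b]. Otherwise an entry of [a] missing from
   [b] gives a zero row. *)
have [sab|] := boolP (all (mem b) a).
  case: ab; apply: incr_eq => //.
  apply: (uniq_min_size (incr_uniq ia) (allP sab) _).2.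
  by rewrite !size_tuple.
rewrite -has_predC => /hasP[_ /tnthP[i ->] /= bi].
rewrite (expand_det_row _ i) big1 // => j _; rewrite !mxE.
case: eqP => [e|_]; last by rewrite mul0r.
by case/negP: bi; rewrite e mem_tnth.
Qed.

(** The compound of a unitary matrix is unitary: this is [minor_conj_diag] with [d] constantly 1. *)
Lemma unitary_minors (C : numClosedFieldType) n k (U : 'M[C]_n) :
  U \is unitarymx -> forall a b : k.-tuple 'I_n, incr a -> incr b ->
  \sum_(t : k.-tuple 'I_n | incr t)
    \det (mxsub (tnth a) (tnth t) U) * (\det (mxsub (tnth b) (tnth t) U))^* =
  (a == b)%:R.
Proof.
move=> Uu a b ia ib; rewrite -(det_mxsub1 C ia ib).
rewrite -(unitarymxP Uu) -{3}(mulmx1 U).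
have -> : 1%:M = diag_mx (\row_j 1) :> 'M[C]_n.
  by rewrite -scalemx1 -diag_const_mx scale1r; congr diag_mx; apply/rowP => j; rewrite !mxE.
rewrite minor_conj_diag; apply: eq_bigr => t _.
by rewrite [\prod_(_ < _) _]big1 ?mulr1.
Qed.

(** * The relation [uds] for compounds *)

Section Uds.
Variable R : realType.
Local Notation C := R[i].

Lemma CseqE n k (z : seq C) : size z = n ->
  Cseq k z = [seq \prod_(j < k) z`_(tnth t j)
             | t : k.-tuple 'I_n <- enum [set t : k.-tuple 'I_n | incr t]].
Proof. by case: n /. Qed.

Lemma Re_sqr_norm (x : C) : (complex.Re (`|x| ^+ 2))%:C = `|x| ^+ 2.
Proof. by rewrite RRe_real // realX // normr_real. Qed.

(** Passes from matrices indexed by arbitrary labels, such as tuples, to ordinals. [L] and [E] order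
    the rows and columns separately, so that the labels of [x] can come first; [i0] is a default for
    [nth]. *)
Lemma uds_of_orthonormal (I : eqType) (i0 : I) (L E : seq I) (V : I -> I -> C)
    (f g : I -> C) (x x' : seq C) :
  uniq L -> size L = size E ->
  {in L &, forall a b, \sum_(c <- E) V a c * (V b c)^* = (a == b)%:R} ->
  {in L, forall a, g a = \sum_(c <- E) `|V a c| ^+ 2 * f c} ->
  x ++ x' = map g L ->
  uds x (map f E).
Proof.
move=> uL sLE orth gE xE.
have sE : size E = size (map f E) by rewrite size_map.
have inL (i : 'I_(size (map f E))) : nth i0 L i \in L.
  by rewrite mem_nth // sLE sE.
exists x', (\matrix_(i, j) complex.Re (`|V (nth i0 L i) (nth i0 E j)| ^+ 2)).
split; first by rewrite xE !size_map.
  exists (\matrix_(i, j) V (nth i0 L i) (nth i0 E j)) => [|i j]; last first.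
    by rewrite !mxE Re_sqr_norm.
  apply/unitarymxP/matrixP => i j; rewrite !mxE.
  rewrite -(inj_eq val_inj) -(nth_uniq i0 _ _ uL) ?sLE ?sE ?ltn_ord //.
  rewrite -orth ?inL // (big_nth i0) sE big_mkord.
  by apply: eq_bigr => l _; rewrite !mxE.
apply/matrixP => i j; rewrite !mxE xE (nth_map i0) ?sLE ?sE // gE ?inL //.
rewrite (big_nth i0) sE big_mkord; apply: eq_bigr => l _.
by rewrite !mxE Re_sqr_norm (nth_map i0) ?sE.
Qed.

(** Since [lift ord_max] preserves values, increasing tuples become those that avoid the last index,
    the one outside the triangular compression. *)
Definition widen_incr n k (t : k.-tuple 'I_n) : k.-tuple 'I_n.+1 :=
  map_tuple (lift ord_max) t.

Lemma val_widen_incr n k (t : k.-tuple 'I_n) :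
  map val (widen_incr t) = map val t.
Proof. by rewrite /= -map_comp; apply: eq_map => i; exact: lift_max. Qed.

Lemma widen_incr_inj n k : injective (@widen_incr n k).
Proof.
by move=> s t e; apply/val_inj/(inj_map val_inj); rewrite -[LHS]val_widen_incr e val_widen_incr.
Qed.

(** Principal minors of the shifted matrix avoiding the last index are products of the [mu - alpha];
    those containing it supply the extra entries [x']. *)
Lemma uds_compound n k (lam : n.+1.-tuple C) (mu : n.-tuple C) (alpha : C)
    (U : 'M[C]_n.+1) (s : {perm 'I_n}) :
  let A := U *m diag_mx (\row_i tnth lam i) *m U^t* in
  U \is unitarymx ->
  (forall i, A (lift ord_max i) (lift ord_max i) = tnth mu i) ->
  (forall i j, (s i < s j)%N -> A (lift ord_max i) (lift ord_max j) = 0) ->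
  uds (Cseq k [seq z - alpha | z <- mu]) (Cseq k [seq z - alpha | z <- lam]).
Proof.
move=> A Uu Adiag Atrig.
rewrite [Cseq _ (map _ lam)](@CseqE n.+1) ?size_map ?size_tuple //.
rewrite (@CseqE n) ?size_map ?size_tuple //.
set E' := enum _; set E := enum _.
have memE t : (t \in E) = incr t by rewrite mem_enum inE.
have memE' t : (t \in E') = incr t by rewrite mem_enum inE.
pose L1 := map (@widen_incr n k) E'.
pose L2 := [seq t <- E | t \notin L1].
have L1E t : t \in L1 -> t \in E.
  by case/mapP => t'; rewrite memE' => it' ->; rewrite memE /incr val_widen_incr.
have uE : uniq E by exact: enum_uniq.
have uL : uniq (L1 ++ L2).
  rewrite cat_uniq (map_inj_uniq (@widen_incr_inj _ _)) enum_uniq filter_uniq //.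
  rewrite andbT; apply/hasPn => t; rewrite mem_filter => /andP[]//.
have LE : L1 ++ L2 =i E.
  move=> t; rewrite mem_cat mem_filter.
  by have [/L1E ->|] := boolP (t \in L1).
pose d i := tnth lam i - alpha.
pose A' := U *m diag_mx (\row_i d i) *m U^t*.
(* Orthonormality of the rows of [U] turns the shift of [lam] into subtraction of a scalar matrix,
   which leaves off-diagonal entries alone. *)
have A'E i j : A' i j = A i j - (i == j)%:R * alpha.
  rewrite !conj_diagE -(unitarymx_rowE Uu) mulr_suml -sumrB.
  by apply: eq_bigr => l _; rewrite mulrBr.
have sumE (F : k.-tuple 'I_n.+1 -> C) : \sum_(t <- E) F t = \sum_(t | incr t) F t.
  by rewrite /E big_enum; apply: eq_bigl => t; rewrite inE.
pose g (t : k.-tuple 'I_n.+1) := \det (mxsub (tnth t) (tnth t) A').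
apply: (uds_of_orthonormal [tuple of nseq k ord0] (L := L1 ++ L2)
  (V := fun a t => \det (mxsub (tnth a) (tnth t) U)) (g := g)
  (x' := map g L2)) => //.
- by apply: perm_size; exact: uniq_perm.
- by move=> a b; rewrite !LE !memE => ia ib; rewrite sumE unitary_minors.
- move=> a _; rewrite sumE /g minor_conj_diag; apply: eq_bigr => t _.
  rewrite normCK; congr (_ * _); apply: eq_bigr => j _.
  by rewrite (nth_map 0) ?size_tuple // -tnth_nth.
rewrite map_cat; congr (_ ++ _); rewrite -map_comp; apply/eq_in_map => t.
rewrite memE' => it /=; have injt : injective (tnth t) by exact/tuple_uniqP/incr_uniq.
(* The rank [s] makes the selected submatrix triangular. *)
rewrite /g (@det_ranked _ _ _ (fun i => s (tnth t i))) => [|i j /val_inj/perm_inj/injt //|i j sij].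
  apply: eq_bigr => j _; rewrite mxE A'E tnth_map Adiag eqxx mul1r.
  by rewrite (nth_map 0) ?size_tuple // -tnth_nth.
rewrite mxE A'E !tnth_map Atrig // (inj_eq lift_inj) (inj_eq injt).
by case: eqP sij => [->|_ _]; rewrite ?ltnn // mul0r subr0.
Qed.

End Uds.

(** * The roots of the derivative and the conclusion *)

Lemma deriv_roots (R : realType) n (p : {poly R[i]}) (lam : n.+1.-tuple R[i])
    (mu : n.-tuple R[i]) :
  p != 0 -> roots_of p lam -> roots_of p^`() mu ->
  (\prod_i ('X - (tnth lam i)%:P))^`() = n.+1%:R *: \prod_(z <- mu) ('X - z%:P).
Proof.
move=> p0 pE p'E; have c0 : lead_coef p != 0 by rewrite lead_coef_eq0.
set Q := \prod_i _.
have QE : Q = \prod_(z <- lam) ('X - z%:P) by rewrite big_tuple.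
have Q'E : Q^`() = ((lead_coef p)^-1 * lead_coef p^`()) *: \prod_(z <- mu) ('X - z%:P).
  by rewrite -scalerA -p'E {2}pE derivZ scalerA mulVf // scale1r QE.
have lead1 (s : seq R[i]) : (\prod_(z <- s) ('X - z%:P))`_(size s) = 1.
  have /monicP := monic_prod_XsubC s xpredT id.
  by rewrite /lead_coef size_prod_XsubC.
(* The scalar is found by comparing coefficients of degree [n], both products being monic. *)
rewrite Q'E; congr (_ *: _).
have := congr1 (fun q : {poly R[i]} => q`_n) Q'E.
have := lead1 lam; have := lead1 mu; rewrite !size_tuple => l1 l2.
by rewrite coefZ l1 mulr1 coef_deriv QE l2.
Qed.

Theorem proposition4p2 (R : realType) (n : nat) (p : {poly R[i]})
    (lambda : n.-tuple R[i]) (mu : n.-1.-tuple R[i]) :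
  (2 <= n)%N ->
  size p = n.+1 ->
  roots_of p lambda ->
  roots_of p^`() mu ->
  (forall (alpha : R[i]) (k : nat), (1 <= k <= n.-1)%N ->
     uds (Cseq k [seq m - alpha | m <- mu])
         (Cseq k [seq l - alpha | l <- lambda]))
  /\
  (exists S : 'M[R]_n,
     bistochastic S /\
     colvec n (rcons mu (n%:R^-1 * \sum_(l <- lambda) l))
     = map_mx (real_complex R) S *m colvec n lambda).
Proof.
case: n lambda mu => [|[|m]] //= lambda mu _ sp rp rp'.
have p0 : p != 0 by rewrite -size_poly_eq0 sp.
have [U [s [Uu Adiag Atrig Ulast]]] :=
  unitary_triangularization (deriv_roots p0 rp rp').
split=> [alpha k _|]; first exact: uds_compound Uu Adiag Atrig.
pose S : 'M[R]_m.+2 := \matrix_(i, j) complex.Re (`|U i j| ^+ 2).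
have SE i j : (S i j)%:C = `|U i j| ^+ 2 by rewrite mxE Re_sqr_norm.
exists S; split.
  have inj1 := fmorph_inj (real_complex R).
  split=> [i j|i|j].
  - by rewrite -ler0c SE exprn_ge0.
  - apply: inj1; rewrite rmorph_sum rmorph1 /=.
    have := unitarymx_rowE Uu i i; rewrite eqxx mulr1n => <-.
    by apply: eq_bigr => j _; rewrite SE normCK.
  - apply: inj1; rewrite rmorph_sum rmorph1 /=.
    have Utu : U^T \is unitarymx by rewrite trmx_unitary.
    have := unitarymx_rowE Utu j j; rewrite eqxx mulr1n => <-.
    by apply: eq_bigr => i _; rewrite SE !mxE normCK.
apply/matrixP => i z; rewrite !mxE nth_rcons size_tuple.
transitivity (\sum_j `|U i j| ^+ 2 * tnth lambda j); last first.
  by apply: eq_bigr => j _; rewrite ![in RHS]mxE Re_sqr_norm (tnth_nth 0).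
(* Rows other than the last read off the diagonal of the compression; the flat last row averages the
   roots. *)
case: (unliftP ord_max i) => [j|] ->.
  rewrite lift_max ltn_ord -tnth_nth -Adiag conj_diagE.
  by apply: eq_bigr => l _; rewrite -normCK.
rewrite ltnn eqxx big_tuple mulr_sumr.
by apply: eq_bigr => l _; rewrite Ulast.
Qed.
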